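(* Let $T$ be an $\mathrm{NTP}_2$ theory and $A$ a (small) set of parameters. Then a formula $\varphi(x,a)$ divides over $A$ if and only if it array-divides over $A$.
   Context: $T$ is a complete first-order theory and we work in a monster model $\mathbb{M}\models T$; $x,y$, and the elements $a$, $a_{ij}$ denote (finite) tuples. $\mathrm{NTP}_2$: a formula $\varphi(x,y)$ is $\mathrm{TP}_2$ if there are $(a_{ij})_{i,j\in\omega}$ and $k\in\omega$ such that $\{\varphi(x,a_{ij})\}_{j\in\omega}$ is $k$-inconsistent for each $i\in\omega$, while $\{\varphi(x,a_{if(i)})\}_{i\in\omega}$ is consistent for each $f:\omega\to\omega$. A formula is $\mathrm{NTP}_2$ if it is not $\mathrm{TP}_2$, and $T$ is $\mathrm{NTP}_2$ if every formula is $\mathrm{NTP}_2$. An array $(a_{ij})_{i,j\in\omega}$ is an indiscernible array over $A$ (an $A$-indiscernible array) if both the sequence of rows $((a_{ij})_{j\in\omega})_{i\in\omega}$ and the sequence of columns $((a_{ij})_{i\in\omega})_{j\in\omega}$ are $A$-indiscernible sequences. $\varphi(x,a)$ array-divides over $A$ if there is an $A$-indiscernible array $(a_{ij})_{i,j\in\omega}$ such that $a_{00}=a$ and $\{\varphi(x,a_{ij})\}_{i,j\in\omega}$ is inconsistent. Dividing over $A$ has its usual meaning (there is an $A$-indiscernible sequence $(a_i)_{i\in\omega}$ with $a_0=a$ and $\{\varphi(x,a_i)\}_{i\in\omega}$ inconsistent). *)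

(* Defs.v *)
From mathcomp Require Import all_boot all_classical.

Set Implicit Arguments.
Unset Strict Implicit.
Unset Printing Implicit Defensive.

Local Open Scope classical_set_scope.
Local Open Scope card_scope.

Record language := Language {
  fsym : Type;
  farity : fsym -> nat;
  rsym : Type;
  rarity : rsym -> nat
}.

(* Variables are drawn from an arbitrary type [V]; a formula phi(x, y) with   *)
(* |x| = n and |y| = m is an element of [formula L ('I_n + 'I_m)], and        *)
(* L(A)-formulas are obtained by using the elements of A as extra variables,  *)
(* interpreted by themselves.                                                 *)
Inductive term (L : language) (V : Type) : Type :=
| Var of V
| App (f : fsym L) of ('I_(farity f) -> term L V).

(* [Forall] binds the variable [None] of [option V]. *)
Inductive formula (L : language) (V : Type) : Type :=
| Falsum
| Equal of term L V & term L V
| Rel (r : rsym L) of ('I_(rarity r) -> term L V)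
| Imp of formula L V & formula L V
| Forall of formula L (option V).

Arguments Var {L V}.
Arguments App {L V}.
Arguments Falsum {L V}.
Arguments Equal {L V}.
Arguments Rel {L V}.
Arguments Imp {L V}.
Arguments Forall {L V}.

Definition Neg (L : language) (V : Type) (phi : formula L V) : formula L V :=
  Imp phi Falsum.

Record structure (L : language) := Structure {
  carrier :> Type;
  carrier_inhabited : inhabited carrier;
  finterp : forall f : fsym L, ('I_(farity f) -> carrier) -> carrier;
  rinterp : forall r : rsym L, ('I_(rarity r) -> carrier) -> Prop
}.

Fixpoint eval (L : language) (M : structure L) (V : Type) (v : V -> M)
    (t : term L V) : M :=
  match t with
  | Var i => v i
  | App f ts => finterp (fun i => eval v (ts i))
  end.

Fixpoint sat (L : language) (M : structure L) (V : Type)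
    (phi : formula L V) : (V -> M) -> Prop :=
  match phi with
  | Falsum => fun _ => False
  | Equal s t => fun v => eval v s = eval v t
  | Rel r ts => fun v => rinterp (fun i => eval v (ts i))
  | Imp p q => fun v => sat p v -> sat q v
  | Forall p => fun v => forall c : M, sat p (oapp v c)
  end.

Definition sentence (L : language) := formula L void.

Definition holds (L : language) (M : structure L) (s : sentence L) : Prop :=
  sat s (of_void M).

Definition theory (L : language) := set (sentence L).

Definition model (L : language) (T : theory L) (M : structure L) : Prop :=
  forall s, T s -> holds M s.

Definition entails (L : language) (T : theory L) (s : sentence L) : Prop :=
  forall M : structure L, model T M -> holds M s.

Definition complete (L : language) (T : theory L) : Prop :=
  (exists M : structure L, model T M) /\
  (forall s, entails T s \/ entails T (Neg s)).

Definition pair_val (V W M : Type) (v : V -> M) (w : W -> M) : V + W -> M :=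
  fun s => match s with inl i => v i | inr j => w j end.

Definition card_lt (T U : Type) (A : set T) (B : set U) : Prop :=
  (A #<= B) /\ ~ (B #<= A).

(* The cardinal kappa is represented by a type of that cardinality. *)
Definition small (kappa : Type) (T : Type) (A : set T) : Prop :=
  card_lt A [set: kappa].

Definition saturated (kappa : Type) (L : language) (M : structure L) : Prop :=
  forall (A : set M), small kappa A ->
  forall (n : nat) (p : set (formula L ('I_n + A))),
    (forall q, finite_set q -> q `<=` p ->
       exists b : 'I_n -> M, forall phi, q phi -> sat phi (pair_val b set_val)) ->
    exists b : 'I_n -> M, forall phi, p phi -> sat phi (pair_val b set_val).

Definition elementary_map (L : language) (M : structure L) (A : set M)
    (h : A -> M) : Prop :=
  forall phi : formula L A, sat phi set_val <-> sat phi h.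

Definition automorphism (L : language) (M : structure L) (s : M -> M) : Prop :=
  [/\ bijective s,
      (forall (f : fsym L) (v : 'I_(farity f) -> M),
         s (finterp v) = finterp (s \o v)) &
      (forall (r : rsym L) (v : 'I_(rarity r) -> M),
         rinterp v <-> rinterp (s \o v))].

Definition strongly_homogeneous (kappa : Type) (L : language)
    (M : structure L) : Prop :=
  forall (A : set M) (h : A -> M), small kappa A -> elementary_map h ->
    exists2 s : M -> M, automorphism s & forall a : A, s (set_val a) = h a.

(* [formula L nat] has cardinality |L| + aleph_0, so kappa is in particular   *)
(* uncountable.                                                               *)
Definition monster (kappa : Type) (L : language) (T : theory L)
    (M : structure L) : Prop :=
  [/\ model T M,
      card_lt [set: formula L nat] [set: kappa],
      saturated kappa M &
      strongly_homogeneous kappa M].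

Section InMonster.
Variables (L : language) (M : structure L).

(* Consistency of {phi(x, a_i)}_{i in I} in the monster-model convention, i.e.*)
(* having a realization in M; here I is always at most countable.             *)
Definition consistent (n m : nat) (phi : formula L ('I_n + 'I_m)) (I : Type)
    (a : I -> 'I_m -> M) : Prop :=
  exists b : 'I_n -> M, forall i, sat phi (pair_val b (a i)).

Definition k_inconsistent (k n m : nat) (phi : formula L ('I_n + 'I_m))
    (I : Type) (a : I -> 'I_m -> M) : Prop :=
  forall s : 'I_k -> I, injective s -> ~ consistent phi (a \o s).

Definition TP2 (n m : nat) (phi : formula L ('I_n + 'I_m)) : Prop :=
  exists (a : nat -> nat -> 'I_m -> M) (k : nat),
    (forall i, k_inconsistent k phi (a i)) /\
    (forall f : nat -> nat, consistent phi (fun i => a i (f i))).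

Definition NTP2 : Prop :=
  forall (n m : nat) (phi : formula L ('I_n + 'I_m)), ~ TP2 phi.

Definition increasing (k : nat) (f : 'I_k -> nat) : Prop :=
  forall i j : 'I_k, (i < j)%N -> (f i < f j)%N.

(* The sequence consists of J-indexed tuples, with J possibly infinite. *)
Definition indiscernible (A : set M) (J : Type) (b : nat -> J -> M) : Prop :=
  forall (k : nat) (f g : 'I_k -> nat), increasing f -> increasing g ->
  forall phi : formula L ('I_k * J + A),
    sat phi (pair_val (fun ij => b (f ij.1) ij.2) set_val) <->
    sat phi (pair_val (fun ij => b (g ij.1) ij.2) set_val).

Definition divides (A : set M) (n m : nat) (phi : formula L ('I_n + 'I_m))
    (a : 'I_m -> M) : Prop :=
  exists b : nat -> 'I_m -> M,
    [/\ indiscernible A b, b 0 = a & ~ consistent phi b].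

Definition indiscernible_array (A : set M) (m : nat)
    (a : nat -> nat -> 'I_m -> M) : Prop :=
  indiscernible A (fun i (jl : nat * 'I_m) => a i jl.1 jl.2) /\
  indiscernible A (fun j (il : nat * 'I_m) => a il.1 j il.2).

Definition array_divides (A : set M) (n m : nat)
    (phi : formula L ('I_n + 'I_m)) (a : 'I_m -> M) : Prop :=
  exists b : nat -> nat -> 'I_m -> M,
    [/\ indiscernible_array A b, b 0 0 = a &
        ~ consistent phi (fun ij : nat * nat => b ij.1 ij.2)].

End InMonster.

(* Main.v *)
Require Import Defs.
From mathcomp Require Import all_boot all_classical zify.

Set Implicit Arguments.
Unset Strict Implicit.
Unset Printing Implicit Defensive.

Local Open Scope classical_set_scope.
Local Open Scope card_scope.

(** Dividing implies array-dividing in any theory: if (b_i) is indiscernible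
    and {phi(x, b_i)} is inconsistent, the array a_ij = b_i has A-indiscernible
    rows, and its columns form a constant sequence.

    Conversely, the diagonal of an A-indiscernible array is A-indiscernible, so
    it is enough to show that, under NTP2, consistency of phi along the diagonal
    forces consistency over the whole array ([array_realized]).  The engine is
    [row_realized]: a consistent diagonal makes the first row consistent.  If
    the row were inconsistent, indiscernibility would make all its K-element
    subsets inconsistent for some K.  In the array c_ij = a_(i, i N + j) with
    i < N and j < N, every choice of one column per row picks increasing columns
    of a, hence a copy of a piece of the diagonal, which is consistent; letting
    N grow, compactness produces a TP2 array.

    The whole array is then reached by regrouping cells and replacing phi by a
    conjunction of instances of phi:
    - the blocks (a_(i p + l, j p + l))_(l < p) form an indiscernible array
      whose diagonal is that of a, so their first row is consistent, that is,
      phi is consistent on the cells (l, j p + l) with l < p and j arbitrary;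
    - these cells contain, up to an increasing renumbering of the columns,
      p rows of the staircase (i, i k + l), l < k, so by compactness the full
      staircase is consistent;
    - the staircase is the diagonal of the array (a_(i, j k + l))_(l < k);
      applying [row_realized] to its transpose shows that phi is consistent on
      the first k columns, and compactness concludes.

    Compactness takes place inside the monster model.  Since saturation is
    about types in finitely many variables, the TP2 array, an infinite tuple,
    is built coordinate by coordinate in [limit_definable].

    Formulas only matter through the sets that they define, so most lemmas are
    about definable predicates on assignments: closure of these under Boolean
    operations, renaming and quantification replaces syntactic
    constructions. *)

(** * Renaming variables and definable predicates *)

Section Renaming.
Variable L : language.

Fixpoint rename_term (V W : Type) (r : V -> W) (t : term L V) : term L W :=
  match t with
  | Var i => Var (r i)
  | App f ts => App f (fun i => rename_term r (ts i))
  end.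

Fixpoint rename (V W : Type) (r : V -> W) (phi : formula L V) : formula L W :=
  match phi with
  | Falsum => Falsum
  | Equal s t => Equal (rename_term r s) (rename_term r t)
  | Rel R ts => Rel R (fun i => rename_term r (ts i))
  | Imp p q => Imp (rename r p) (rename r q)
  | Forall p => Forall (rename (omap r) p)
  end.

Variable M : structure L.

Lemma eval_rename (V W : Type) (r : V -> W) (v : W -> M) (t : term L V) :
  eval v (rename_term r t) = eval (v \o r) t.
Proof.
by elim: t => //= f ts IH; congr finterp; apply: funext => i; apply: IH.
Qed.

Lemma sat_rename (V W : Type) (r : V -> W) (v : W -> M) (phi : formula L V) :
  sat (rename r phi) v <-> sat phi (v \o r).
Proof.
elim: phi W r v => {V} [V|V s t|V R ts|V p IHp q IHq|V p IHp] W r v //=.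
- by rewrite !eval_rename.
- by rewrite (_ : (fun i => eval v (rename_term r (ts i))) =
    (fun i => eval (v \o r) (ts i))) //; apply: funext => i; rewrite eval_rename.
- by rewrite IHp IHq.
- have oappE c : oapp v c \o omap r = oapp (v \o r) c by apply: funext; case.
  by split=> H c; move: (H c); rewrite IHp oappE.
Qed.

Lemma eval_agree (V : Type) (rk : V -> nat) (t : term L V) :
  exists N, forall v v' : V -> M, (forall x, rk x < N -> v x = v' x) ->
    eval v t = eval v' t.
Proof.
elim: t => [x|f ts IH].
  by exists (rk x).+1 => v v' /(_ x (ltnSn _)).
have [N NP] := choice IH.
exists (\max_i N i) => v v' vv' /=; congr finterp; apply: funext => i.
by apply: NP => x lx; apply: vv'; apply: leq_trans lx (leq_bigmax _).
Qed.

(** The rank [rk] lets the induction pass under a quantifier: the bound variable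
    receives rank 0.  For variables in [nat] and [rk := id] this says that a
    formula depends on finitely many variables only. *)
Lemma sat_agree (V : Type) (rk : V -> nat) (phi : formula L V) :
  exists N, forall v v' : V -> M, (forall x, rk x < N -> v x = v' x) ->
    (sat phi v <-> sat phi v').
Proof.
elim: phi rk => {V} [V|V s t|V R ts|V p IHp q IHq|V p IHp] rk /=.
- by exists 0.
- have [N1 H1] := eval_agree rk s; have [N2 H2] := eval_agree rk t.
  exists (maxn N1 N2) => v v' vv'.
  rewrite (H1 v v') 1?(H2 v v') // => x lx; apply: vv';
    by rewrite leq_max lx ?orbT.
- have [N NP] := choice (fun i => eval_agree rk (ts i)).
  exists (\max_i N i) => v v' vv'.
  rewrite (_ : (fun i => eval v (ts i)) = (fun i => eval v' (ts i))) //.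
  apply: funext => i; apply: NP => x lx.
  by apply: vv'; apply: leq_trans lx (leq_bigmax _).
- have [N1 H1] := IHp rk; have [N2 H2] := IHq rk.
  exists (maxn N1 N2) => v v' vv'.
  rewrite (H1 v v') 1?(H2 v v') // => x lx; apply: vv';
    by rewrite leq_max lx ?orbT.
- have [N NP] := IHp (oapp rk 0); exists N => v v' vv'.
  by split=> H c; move: (H c); apply NP => -[x|] //= lx; rewrite vv'.
Qed.

Definition definable (V : Type) (P : (V -> M) -> Prop) : Prop :=
  exists phi : formula L V, forall v, sat phi v <-> P v.

Lemma definable_pull (V W : Type) (r : V -> W) (P : (V -> M) -> Prop) :
  definable P -> definable (fun v => P (v \o r)).
Proof.
by case=> phi phiP; exists (rename r phi) => v; rewrite sat_rename phiP.
Qed.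

Lemma definable_not (V : Type) (P : (V -> M) -> Prop) :
  definable P -> definable (fun v => ~ P v).
Proof. by case=> phi phiP; exists (Neg phi) => v /=; rewrite phiP. Qed.

Lemma definable_iff (V : Type) (P Q : (V -> M) -> Prop) :
  (forall v, P v <-> Q v) -> definable P -> definable Q.
Proof. by move=> PQ [phi phiP]; exists phi => v; rewrite phiP PQ. Qed.

Lemma definable_all_ord (V : Type) k (P : 'I_k -> (V -> M) -> Prop) :
  (forall t, definable (P t)) -> definable (fun v => forall t, P t v).
Proof.
elim: k P => [|k IH] P dP.
  by exists (Neg Falsum) => v; split=> // _ [].
have [phi phiP] := dP ord_max.
have [psi psiP] := IH _ (fun t => dP (widen_ord (leqnSn k) t)).
exists (Neg (Imp phi (Neg psi))) => v /=.
rewrite phiP psiP; split=> [H t|H]; last by apply; [apply: H|move=> t; apply: H].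
have [Pmax Plt] : P ord_max v /\ forall t, P (widen_ord (leqnSn k) t) v.
  by apply: contrapT => nH; apply: H => H1 H2; apply: nH.
have [tk|kt] := ltnP t k.
  by rewrite (_ : t = widen_ord (leqnSn k) (Ordinal tk)) //; apply: val_inj.
rewrite (_ : t = ord_max) //; apply: val_inj => /=.
by apply/eqP; rewrite eqn_leq kt -ltnS ltn_ord.
Qed.

Lemma definable_all (V : Type) (I : finType) (P : I -> (V -> M) -> Prop) :
  (forall t, definable (P t)) -> definable (fun v => forall t, P t v).
Proof.
move=> dP; have := definable_all_ord (fun i : 'I_#|I| => dP (enum_val i)).
apply: definable_iff => v; split=> H t //.
by rewrite -(enum_rankK t).
Qed.

Lemma definable_ex1 (V : Type) (P : (option V -> M) -> Prop) :
  definable P -> definable (fun v => exists c, P (oapp v c)).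
Proof.
case=> phi phiP; exists (Neg (Forall (Neg phi))) => v /=; split=> [H|[c Pc] H].
  apply: contrapT => nP; apply: H => c; rewrite phiP => Pc.
  by apply: nP; exists c.
by apply: (H c); rewrite phiP.
Qed.

(** Quantification over a whole tuple: the n+1-tuple is a head, which becomes
    the variable [None], followed by an n-tuple. *)
Lemma definable_ex n (V : Type) (P : ('I_n + V -> M) -> Prop) :
  definable P -> definable (fun v => exists b, P (pair_val b v)).
Proof.
elim: n V P => [|n IH] V P dP.
  pose r (x : 'I_0 + V) : V :=
    match x with inl i => False_rect _ (notF (ltn_ord i)) | inr x => x end.
  apply: definable_iff (definable_pull r dP) => v.
  have rE b : pair_val b v = v \o r by apply: funext => -[[]|].
  split=> [Pv|[b]]; last by rewrite rE.
  by exists (fun i => v (r (inl i))); rewrite rE.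
pose r (x : 'I_n.+1 + V) : 'I_n + option V :=
  match x with
  | inl i => if unlift ord0 i is Some j then inl j else inr None
  | inr x => inr (Some x)
  end.
have dr := definable_ex1 (IH _ _ (definable_pull r dP)).
apply: definable_iff dr => v; split=> [[c [b Pb]]|[b Pb]].
  exists (fun i => if unlift ord0 i is Some j then b j else c).
  rewrite (_ : pair_val _ _ = pair_val b (oapp v c) \o r) //.
  by apply: funext => -[i|x] //=; case: (unlift ord0 i).
exists (b ord0), (fun j => b (lift ord0 j)).
rewrite (_ : _ \o r = pair_val b v) //.
by apply: funext => -[i|x] //=; case: unliftP => [j ->|->].
Qed.

End Renaming.

(** * Compactness in the monster model *)

Lemma finite_set_listing (T : Type) (q : set T) :
  finite_set q -> exists k (g : 'I_k -> T), forall x, q x <-> exists t, g t = x.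
Proof.
case=> k /card_bijP[f [h fK hK]].
have kE (t : 'I_k) : (t : nat) \in `I_k by rewrite inE /= ltn_ord.
exists k, (fun t : 'I_k => val (h (exist _ (val t) (kE t)))) => x.
split=> [qx|[t <-]].
  pose y : q := exist _ x (mem_set qx).
  have lk : val (f y) < k by have := valP (f y); rewrite inE.
  exists (Ordinal lk); rewrite (_ : exist _ _ _ = f y) ?fK //.
  by apply: val_inj.
exact: set_mem (valP (h _)).
Qed.

(** Saturation over an enumerated countable set of parameters, with finite
    satisfiability expressed by finite families of formulas.  Naming the
    parameters by the enumeration [d] avoids formulas over a subset of [M]. *)
Definition countably_saturated (L : language) (M : structure L) : Prop :=
  forall n (W : countType) (d : W -> M) (p : set (formula L ('I_n + W))),
    (forall k (g : 'I_k -> formula L ('I_n + W)), (forall t, p (g t)) ->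
       exists b, forall t, sat (g t) (pair_val b d)) ->
    exists b, forall phi, p phi -> sat phi (pair_val b d).

(** A countable set is small because there are at least countably many formulas
    and strictly fewer formulas than kappa. *)
Lemma countably_saturated_monster (kappa : Type) (L : language) (T : theory L)
    (M : structure L) : monster kappa T M -> countably_saturated M.
Proof.
case=> _ [leF geF] satM _ n W d p fin_p.
have le_nat : [set: nat] #<= [set: formula L nat].
  have inj : {in [set: nat] &,
      injective (fun i => Equal (Var i) (Var i) : formula L nat)}.
    by move=> i j _ _ [].
  by rewrite -(card_le_eql (inj_card_eq inj)) card_leT.
have le_d : range d #<= [set: formula L nat].
  apply: card_le_trans (card_image_le _ _) (card_le_trans _ le_nat).
  exact: countableP.
have small_d : small kappa (range d).
  split; first exact: card_le_trans leF.
  by move=> ge_d; apply: geF; apply: card_le_trans le_d.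
have dP w : d w \in range d by apply: mem_set; exists w.
pose r (x : 'I_n + W) : 'I_n + range d :=
  match x with inl i => inl i | inr w => inr (exist _ (d w) (dP w)) end.
have rE b : pair_val b set_val \o r = pair_val b d by apply: funext => -[].
have [] := satM _ small_d n [set rename r phi | phi in p].
  move=> q /finite_set_listing[k [g gP]] qp.
  have /choice[h hP] t : exists phi, p phi /\ rename r phi = g t.
    by have [|phi] := qp (g t); [apply/gP; exists t|exists phi].
  have [|b bP] := fin_p _ h; first by move=> t; case: (hP t).
  exists b => phi /gP[t <-]; have [_ <-] := hP t.
  by rewrite sat_rename rE.
move=> b bP; exists b => phi pphi; rewrite -rE -sat_rename.
by apply: bP; exists phi.
Qed.

Section Saturation.
Variables (L : language) (M : structure L).
Hypothesis satM : countably_saturated M.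

Definition eventually (P : nat -> Prop) := exists N0, forall N, N0 <= N -> P N.

(** The analogue of [consistent] for a definable predicate [P]; the parameter
    tuples may be indexed by any type [J], so that cells of an array can be
    grouped without renumbering their coordinates. *)
Definition realized n (J I : Type) (P : ('I_n + J -> M) -> Prop)
    (a : I -> J -> M) : Prop :=
  exists b, forall i, P (pair_val b (a i)).

(** All the formulas share the finitely many variables of [b], so a single use
    of saturation over the parameters [a i j] suffices. *)
Lemma realized_compact n (J : countType) (P : ('I_n + J -> M) -> Prop)
    (a : nat -> J -> M) :
  definable P ->
  (forall N, exists b, forall i, i < N -> P (pair_val b (a i))) ->
  realized P a.
Proof.
case=> phi phiP finP.
pose r i (x : 'I_n + J) : 'I_n + nat * J :=
  match x with inl t => inl t | inr j => inr (i, j) end.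
pose d (ij : nat * J) := a ij.1 ij.2.
have rE b i : pair_val b d \o r i = pair_val b (a i) by apply: funext => -[].
have [] := satM (d := d) (p := [set rename (r i) phi | i in setT]).
  move=> k g gP; have /choice[h hP] t : exists i, rename (r i) phi = g t.
    by have [i] := gP t; exists i.
  have [b bP] := finP (\max_t h t).+1; exists b => t.
  rewrite -hP sat_rename rE phiP; apply: bP.
  by rewrite ltnS leq_bigmax.
move=> b bP; exists b => i; rewrite -phiP -rE -sat_rename.
by apply: bP; exists i.
Qed.

Lemma eventually_all k (P : 'I_k -> nat -> Prop) :
  (forall t, eventually (P t)) -> eventually (fun N => forall t, P t N).
Proof.
move=> /choice[h hP]; exists (\max_t h t) => N leN t; apply: hP.
exact: leq_trans (leq_bigmax _) leN.
Qed.

(** Semantic form of: the free variables of [phi] are below [i]. *)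
Definition supported i (phi : formula L nat) : Prop :=
  forall v v' : nat -> M, (forall k, k < i -> v k = v' k) ->
    (sat phi v <-> sat phi v').

Lemma supported_ex phi : exists i, supported i phi.
Proof. exact: (@sat_agree _ M _ id). Qed.

(** The invariant of the construction of a limit of the assignments [w N]: the
    first [i] coordinates of [c] satisfy every eventually true formula about
    these coordinates. *)
Definition limit_upto (w : nat -> nat -> M) i (c : nat -> M) : Prop :=
  forall phi, supported i phi -> eventually (fun N => sat phi (w N)) -> sat phi c.

Definition update (c : nat -> M) i (x : M) : nat -> M :=
  fun k => if k == i then x else c k.

Lemma update_id (c : nat -> M) i : update c i (c i) = c.
Proof. by apply: funext => k; rewrite /update; case: eqP => [->|]. Qed.

(** The type to be realized by the new coordinate consists of the eventually
    true formulas in the first i+1 variables.  It is finitely satisfiable: if a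
    conjunction chi is eventually true, so is (exists x_i, chi), which involves
    the first [i] variables only and therefore holds at [c]. *)
Lemma limit_upto_step w i c :
  limit_upto w i c -> exists x, limit_upto w i.+1 (update c i x).
Proof.
move=> lim_c.
pose r k : 'I_1 + nat := if k == i then inl ord0 else inr k.
have rE b : pair_val b c \o r = update c i (b ord0).
  by apply: funext => k; rewrite /= /update /r; case: eqP.
pose p := [set rename r phi | phi in
   [set phi | supported i.+1 phi /\ eventually (fun N => sat phi (w N))]].
have [] := satM (d := c) (p := p).
  move=> k g gp.
  have /choice[h hP] t : exists phi, [/\ supported i.+1 phi,
      eventually (fun N => sat phi (w N)) & rename r phi = g t].
    by have [phi [? ?] ?] := gp t; exists phi.
  (* [s] turns the i-th variable into the one bound by a quantifier. *)
  pose s x : option nat := if x == i then None else Some x.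
  have sE v x : oapp v x \o s = update v i x.
    by apply: funext => y; rewrite /= /update /s; case: eqP.
  have [|chi chiP] :=
      @definable_ex1 _ M nat (fun v => forall t, sat (rename s (h t)) v).
    by apply: definable_all => t; exists (rename s (h t)).
  have chiE v : sat chi v <-> exists x, forall t, sat (h t) (update v i x).
    rewrite chiP; split=> -[x xP]; exists x => t; move: (xP t);
    by rewrite sat_rename sE.
  have /chiE[x xP] : sat chi c.
    apply: lim_c => [v v' vv'|].
      have eqh x t : sat (h t) (update v i x) <-> sat (h t) (update v' i x).
        have [+ _ _] := hP t; apply=> z; rewrite ltnS /update leq_eqVlt.
        by case: eqP => //= _ lz; rewrite vv'.
      by rewrite !chiE; split=> -[x xP]; exists x => t; apply/eqh.
    have [N0 N0P] : eventually (fun N => forall t, sat (h t) (w N)).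
      by apply: eventually_all => t; case: (hP t).
    exists N0 => N leN; rewrite chiE; exists (w N i) => t.
    by rewrite update_id; apply: N0P.
  exists (fun _ => x) => t; have [_ _ <-] := hP t.
  by rewrite sat_rename rE.
move=> b bP; exists (b ord0) => phi sphi ephi; rewrite -rE -sat_rename.
by apply: bP; exists phi.
Qed.

Lemma limit_nat (w : nat -> nat -> M) :
  exists c : nat -> M, forall phi : formula L nat,
    eventually (fun N => sat phi (w N)) -> sat phi c.
Proof.
have base : limit_upto w 0 (w 0).
  move=> phi sphi [N NP]; apply: (sphi (w N) _ _).1 => //; exact: NP.
pose step i (c : {c | limit_upto w i c}) : {c | limit_upto w i.+1 c} :=
  let x := cid (limit_upto_step (svalP c)) in
  exist _ (update (sval c) i (sval x)) (svalP x).
pose F := fix F i : {c | limit_upto w i c} :=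
  if i is j.+1 then step j (F j) else exist _ (w 0) base.
have FE k i : k < i -> sval (F i) k = sval (F k.+1) k.
  elim: i => // i IH; rewrite ltnS leq_eqVlt => /predU1P[->//|lt].
  by rewrite -IH //= /update ltn_eqF.
exists (fun k => sval (F k.+1) k) => phi ephi; have [i iP] := supported_ex phi.
apply: (iP (sval (F i)) _ _).1; last by apply: (svalP (F i)).
by move=> k; apply: FE.
Qed.

(** Countable saturation for infinite tuples.  It is used like a non-principal
    ultraproduct: the finite approximations [w N] have a limit that keeps all
    their eventual first-order properties. *)
Lemma limit_definable (V : countType) (w : nat -> V -> M) :
  exists c : V -> M, forall P, definable P ->
    eventually (fun N => P (w N)) -> P c.
Proof.
have [x0] := carrier_inhabited M.
pose w' N k := if unpickle k is Some x then w N x else x0.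
have w'E N : w' N \o pickle = w N by apply: funext => x; rewrite /= /w' pickleK.
have [c cP] := limit_nat w'; exists (c \o pickle) => P [phi phiP] [N0 NP].
rewrite -phiP -sat_rename; apply: cP; exists N0 => N leN.
by rewrite sat_rename w'E phiP; apply: NP.
Qed.

End Saturation.

(** * Indiscernible arrays *)

Lemma increasing_enum k (s : 'I_k -> nat) : injective s ->
  exists2 tau : nat -> nat, {homo tau : i j / i < j} &
    forall t : 'I_k, exists t', tau t = s t'.
Proof.
move=> inj_s; pose l := sort leq (codom s).
have size_l : size l = k by rewrite size_sort size_codom card_ord.
have l_sorted : sorted ltn l.
  rewrite ltn_sorted_uniq_leq sort_uniq (sort_sorted leq_total) andbT.
  by apply/injectiveP.
pose top := \max_(x <- l) x.
(* Beyond [k], any values above those of [s] extend [tau] to all of [nat]. *)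
exists (fun i => if i < k then nth 0 l i else (top + i).+1).
  move=> i j ij /=; case: (ltnP i k) => ik; case: (ltnP j k) => jk; last by lia.
  - by apply: (sorted_ltn_nth ltn_trans) => //; rewrite inE size_l.
  - rewrite ltnS; apply: leq_trans (leq_addr _ _).
    by apply: (bigmaxn_sup_seq (nth 0 l i)) => //; rewrite mem_nth ?size_l.
  - by lia.
move=> t; rewrite ltn_ord.
have : nth 0 l t \in codom s by rewrite -(mem_sort leq) mem_nth ?size_l.
by case/codomP => t' ->; exists t'.
Qed.

Section Arrays.
Variables (L : language) (M : structure L).

Lemma indiscernible_definable (A : set M) (J : Type) (b : nat -> J -> M) k
    (f g : 'I_k -> nat) (P : ('I_k * J -> M) -> Prop) :
  indiscernible A b -> increasing f -> increasing g -> definable P ->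
  P (fun ij => b (f ij.1) ij.2) <-> P (fun ij => b (g ij.1) ij.2).
Proof.
move=> indb incf incg [phi phiP].
by have := indb k f g incf incg (rename inl phi); rewrite !sat_rename !phiP.
Qed.

(** The form of indiscernibility that is convenient for rearranging arrays:
    moving finitely many cells by increasing maps on row and column numbers
    preserves their joint type over the empty set.  Unlike [indiscernible_array], this form is
    visibly stable under transposition and under grouping cells. *)
Definition shift_invariant (J : Type) (e : nat -> nat -> J -> M) : Prop :=
  forall (sigma tau : nat -> nat),
    {homo sigma : i j / i < j} -> {homo tau : i j / i < j} ->
  forall (I : finType) (r c : I -> nat) (P : (I * J -> M) -> Prop), definable P ->
    P (fun tu => e (r tu.1) (c tu.1) tu.2) <->
    P (fun tu => e (sigma (r tu.1)) (tau (c tu.1)) tu.2).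

(** Only finitely many terms of the sequence occur in [P], so [sigma] can be
    restricted to the initial segment of length [K] that contains them. *)
Lemma indiscernible_shift (A : set M) (J : Type) (b : nat -> nat * J -> M)
    (sigma : nat -> nat) (I : finType) (r c : I -> nat) (P : (I * J -> M) -> Prop) :
  indiscernible A b -> {homo sigma : i j / i < j} -> definable P ->
  P (fun tu => b (r tu.1) (c tu.1, tu.2)) <->
  P (fun tu => b (sigma (r tu.1)) (c tu.1, tu.2)).
Proof.
move=> indb sigma_inc dP.
pose K := (\max_t r t).+1.
pose q (tu : I * J) : 'I_K * (nat * J) := (inord (r tu.1), (c tu.1, tu.2)).
have qE t : nat_of_ord (inord (r t) : 'I_K) = r t.
  by rewrite inordK // ltnS leq_bigmax.
have := indiscernible_definable (f := fun i : 'I_K => i)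
  (g := fun i : 'I_K => sigma i) indb _ _ (definable_pull q dP).
rewrite (_ : _ \o q = fun tu => b (r tu.1) (c tu.1, tu.2)); last first.
  by apply: funext => -[t u] /=; rewrite qE.
rewrite (_ : _ \o q = fun tu => b (sigma (r tu.1)) (c tu.1, tu.2)); last first.
  by apply: funext => -[t u] /=; rewrite qE.
by apply=> // i j; apply: sigma_inc.
Qed.

Lemma indiscernible_array_shift (A : set M) m (a : nat -> nat -> 'I_m -> M) :
  indiscernible_array A a -> shift_invariant a.
Proof.
case=> rows cols sigma tau sigma_inc tau_inc I r c P dP.
rewrite (indiscernible_shift r c rows sigma_inc dP).
exact: (indiscernible_shift c (sigma \o r) cols tau_inc dP).
Qed.

Lemma shift_invariant_transpose (J : Type) (e : nat -> nat -> J -> M) :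
  shift_invariant e -> shift_invariant (fun i j => e j i).
Proof.
by move=> inv sigma tau si ti I r c P dP; apply: (inv tau sigma ti si I c r).
Qed.

(** The increasing map that moves the i-th block of length [p] onto the
    (sigma i)-th one. *)
Definition spread (sigma : nat -> nat) p i := sigma (i %/ p) * p + i %% p.

Lemma spread_increasing sigma p : 0 < p -> {homo sigma : i j / i < j} ->
  {homo spread sigma p : i j / i < j}.
Proof.
move=> p0 inc i j ij; rewrite /spread.
have := leq_div2r p (ltnW ij); rewrite leq_eqVlt => /predU1P[eq|/inc lt].
  rewrite eq ltn_add2l; move: ij.
  by rewrite {1}(divn_eq i p) {1}(divn_eq j p) eq ltn_add2l.
have := leq_mul lt (leqnn p); have := ltn_pmod i p0; rewrite mulSn; lia.
Qed.

Lemma spreadE sigma p i l : l < p -> spread sigma p (i * p + l) = sigma i * p + l.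
Proof.
move=> lp; have p0 : 0 < p by lia.
by rewrite /spread divnMDl // divn_small // addn0 modnMDl modn_small.
Qed.

(** Grouping into one tuple the cells at offsets [(x l, y l)], l < k, of each
    p x q block: a shift of the blocks is induced by the shift [spread] of the
    underlying cells. *)
Lemma shift_invariant_blocks (J : Type) (e : nat -> nat -> J -> M) p q k
    (x : 'I_k -> 'I_p) (y : 'I_k -> 'I_q) :
  shift_invariant e ->
  shift_invariant (fun i j (lu : 'I_k * J) =>
    e (i * p + x lu.1) (j * q + y lu.1) lu.2).
Proof.
move=> inv sigma tau si ti I r c P dP.
have [k0|k0] := posnP k.
  rewrite (_ : (fun _ => _) = fun tu => e (sigma (r tu.1) * p + x tu.2.1)
    (tau (c tu.1) * q + y tu.2.1) tu.2.2) //; apply: funext => -[t [l u]].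
  by have := ltn_ord l; rewrite [X in _ < X]k0.
have p0 : 0 < p by case: p x => // x; case: (x (Ordinal k0)).
have q0 : 0 < q by case: q y => // y; case: (y (Ordinal k0)).
pose z (tlu : I * ('I_k * J)) := ((tlu.1, tlu.2.1), tlu.2.2).
have := inv _ _ (spread_increasing p0 si) (spread_increasing q0 ti)
  (I * 'I_k)%type (fun tl => r tl.1 * p + x tl.2)
  (fun tl => c tl.1 * q + y tl.2) _ (definable_pull z dP).
rewrite [X in _ <-> P X](_ : _ = fun tu => e (sigma (r tu.1) * p + x tu.2.1)
    (tau (c tu.1) * q + y tu.2.1) tu.2.2) //.
by apply: funext => -[t [l u]] /=; rewrite !spreadE.
Qed.

Hypothesis satM : countably_saturated M.
Hypothesis ntp2 : NTP2 M.

Lemma NTP2_finType n (J : finType) (P : ('I_n + J -> M) -> Prop)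
    (a : nat -> nat -> J -> M) k : definable P ->
  (forall i (s : 'I_k -> nat), injective s -> ~ realized P (a i \o s)) ->
  ~ (forall f : nat -> nat, realized P (fun i => a i (f i))).
Proof.
case=> phi phiP inc_rows con_paths.
pose r (x : 'I_n + J) : 'I_n + 'I_#|J| :=
  match x with inl i => inl i | inr j => inr (enum_rank j) end.
have rE b i j : sat (rename r phi) (pair_val b (a i j \o enum_val)) <->
    P (pair_val b (a i j)).
  rewrite sat_rename phiP (_ : _ \o r = pair_val b (a i j)) //.
  by apply: funext => -[|u] //=; rewrite enum_rankK.
apply: (ntp2 (phi := rename r phi)).
exists (fun i j => a i j \o enum_val), k; split.
  move=> i s /(inc_rows i) nr [b bP]; apply: nr; exists b => t.
  exact/(rE b i (s t))/bP.
by move=> f; have [b bP] := con_paths f; exists b => i; apply/(rE b i (f i)).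
Qed.

Lemma definable_realized n (J V : Type) (I : finType)
    (P : ('I_n + J -> M) -> Prop) (q : I -> J -> V) : definable P ->
  definable (fun v : V -> M => realized P (fun t => v \o q t)).
Proof.
move=> dP.
pose r t (x : 'I_n + J) : 'I_n + V :=
  match x with inl i => inl i | inr j => inr (q t j) end.
have := definable_ex (definable_all (fun t => definable_pull (r t) dP)).
have rE b v t : pair_val b v \o r t = pair_val b (v \o q t).
  by apply: funext => -[].
apply: definable_iff => v.
by split=> -[b bP]; exists b => t; have := bP t; rewrite rE.
Qed.

Lemma realized_shift n (J : Type) (e : nat -> nat -> J -> M) (sigma tau : nat -> nat)
    (I : finType) (r c : I -> nat) (P : ('I_n + J -> M) -> Prop) :
  shift_invariant e ->
  {homo sigma : i j / i < j} -> {homo tau : i j / i < j} -> definable P ->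
  realized P (fun t => e (r t) (c t)) <->
  realized P (fun t => e (sigma (r t)) (tau (c t))).
Proof.
move=> inv si ti dP.
exact: (inv _ _ si ti I r c _ (definable_realized (fun t u => (t, u)) dP)).
Qed.

(** If the first row were inconsistent, some [K] of its cells would already be,
    and by indiscernibility any [K] cells of any row.  The arrays
    [e i (i * N + j)] would then tend to a TP2 array as [N] grows. *)
Lemma row_realized n (J : finType) (P : ('I_n + J -> M) -> Prop)
    (e : nat -> nat -> J -> M) :
  definable P -> shift_invariant e ->
  realized P (fun i => e i i) -> realized P (e 0).
Proof.
move=> dP inv [b0 b0P]; apply: realized_compact => // K; apply: contrapT => nK.
have rowK i (s : 'I_K -> nat) : injective s -> ~ realized P (e i \o s).
  move=> /increasing_enum[tau tau_inc tauP] [b bP]; apply: nK.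
  have [||b' b'P] := (realized_shift (fun=> 0) (fun t : 'I_K => t) inv
      (sigma := addn i) _ tau_inc dP).2.
  - by move=> x y; rewrite ltn_add2l.
  - exists b => t; rewrite addn0; have [t' ->] := tauP t; exact: bP.
  by exists b' => j jK; apply: (b'P (Ordinal jK)).
pose w N (x : nat * nat * J) := e x.1.1 (x.1.1 * N + x.1.2) x.2.
have [c cP] := limit_definable satM w.
apply: (NTP2_finType (P := P) (a := fun i j u => c (i, j, u)) (k := K) dP).
  move=> i s inj_s.
  apply: (cP _ (definable_not (definable_realized (fun t u => (i, s t, u)) dP))).
  exists 0 => N _; apply: (rowK i (fun t => i * N + s t)).
  by move=> t t' /addnI /inj_s.
move=> f; apply: realized_compact => // N0.
have [|b bP] := cP _ (definable_realized (fun (t : 'I_N0) u => (val t, f t, u)) dP).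
  exists (\max_(t < N0) f t).+1 => N leN.
  (* Row [i] uses column [f i < N] of the [i]-th block of columns, so the
     chosen columns increase with [i] and the path is a shifted diagonal. *)
  pose tau i := i * N + (if i < N0 then f i else 0).
  have tauN i : (if i < N0 then f i else 0) < N.
    case: (ltnP i N0) => iN; last exact: (leq_ltn_trans (leq0n _) leN).
    by apply: leq_trans leN; rewrite ltnS (leq_bigmax (Ordinal iN)).
  have tau_inc : {homo tau : i j / i < j}.
    move=> i j ij; rewrite /tau; have := tauN i.
    have := leq_mul ij (leqnn N); rewrite mulSn; lia.
  have [+ _] := realized_shift (fun t : 'I_N0 => t) (fun t : 'I_N0 => t) inv
      (sigma := id) (fun _ _ h => h) tau_inc dP.
  case; first by exists b0 => t; apply: b0P.
  move=> b bP; exists b => t; have := bP t.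
  by rewrite /tau ltn_ord.
by exists b => i iN; apply: (bP (Ordinal iN)).
Qed.

(** The cells on which [P] is known to be consistent grow from the diagonal to
    the scattered cells (l, j p + l), then to the staircase (i, i k + l), then
    to the strip of the first k columns, and finally to the whole array. *)
Lemma array_realized n (J : finType) (P : ('I_n + J -> M) -> Prop)
    (a : nat -> nat -> J -> M) :
  definable P -> shift_invariant a -> realized P (fun i => a i i) ->
  exists b, forall i j, P (pair_val b (a i j)).
Proof.
move=> dP inv [b0 b0P].
pose all_blocks k (v : 'I_n + 'I_k * J -> M) := forall l : 'I_k,
  P (v \o (fun x => match x with inl i => inl i | inr u => inr (l, u) end)).
have all_blocksE k b (c : 'I_k * J -> M) :
    all_blocks k (pair_val b c) <-> forall l, P (pair_val b (fun u => c (l, u))).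
  by split=> H l; have := H l; rewrite (_ : _ \o _ = pair_val b (fun u => c (l, u)))
    //; apply: funext => -[].
have def_blocks k : definable (all_blocks k).
  by apply: definable_all => l; apply: definable_pull.
have scattered p : exists b, forall j (l : 'I_p), P (pair_val b (a l (j * p + l))).
  have [|b bP] := row_realized (def_blocks p)
      (shift_invariant_blocks (p := p) (q := p) id id inv).
    by exists b0 => i; apply/all_blocksE => l /=; apply: b0P.
  exists b => j l; have /all_blocksE := bP j.
  by move=> /(_ l) /=; rewrite mul0n add0n.
have staircase k : exists b, forall i (l : 'I_k), P (pair_val b (a i (i * k + l))).
  pose e i (lu : 'I_k * J) := a i (i * k + lu.1) lu.2.
  have [N|b bP] := realized_compact satM (a := e) (def_blocks k).
    have [b1 b1P] := scattered N.+1.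
    (* Step [s = i * k + l] of the staircase, in row [i], goes to the [s]-th
       column available to row [i] among the scattered cells of period [N.+1].
       The minimum makes [tau] increasing beyond the first [N] rows, and the
       period exceeds [N] so that this also holds for [N = 0]. *)
    pose tau s := s * N.+1 + minn (s %/ k) N.
    have tau_inc : {homo tau : s t / s < t}.
      move=> s t st; rewrite /tau; apply: leq_trans (leq_addr _ _).
      apply: leq_trans (leq_mul st (leqnn N.+1)).
      by rewrite mulSn -addnS addnC leq_add2r ltnS geq_minr.
    have [_ +] := realized_shift (I := ('I_N * 'I_k)%type) (fun il => il.1)
      (fun il => il.1 * k + il.2) inv (sigma := id) (fun _ _ h => h) tau_inc dP.
    case=> [|b bP].
      exists b1 => -[i l] /=; have k0 : 0 < k by case: (k) l => [[]|].
      rewrite /tau divnMDl // divn_small // addn0 (minn_idPl (ltnW (ltn_ord i))).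
      exact: (b1P _ (widen_ord (leqnSn N) i)).
    exists b => i iN; apply/all_blocksE => l.
    exact: (bP (Ordinal iN, l)).
  by exists b => i l; have /all_blocksE /(_ l) := bP i.
have strip k : exists b, forall i (l : 'I_k), P (pair_val b (a i l)).
  have := row_realized (def_blocks k) (shift_invariant_transpose
    (shift_invariant_blocks (p := 1) (q := k) (fun=> ord0) id inv)).
  have [b bP] := staircase k; case=> [|b' b'P].
    by exists b => i; apply/all_blocksE => l /=; rewrite muln1 addn0; apply: bP.
  exists b' => i l; have /all_blocksE /(_ l) /= := b'P i.
  by rewrite mul0n add0n muln1 addn0.
pose cell s : nat * nat := odflt (0, 0) (unpickle s).
have [k|b bP] := realized_compact satM (J := J)
  (a := fun s => a (cell s).1 (cell s).2) dP.
  have [b bP] := strip (\max_(s < k) (cell s).2).+1.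
  exists b => s sk; have lt : (cell s).2 < (\max_(s < k) (cell s).2).+1.
    by rewrite ltnS (leq_bigmax (F := fun s : 'I_k => (cell s).2) (Ordinal sk)).
  exact: (bP (cell s).1 (Ordinal lt)).
by exists b => i j; have := bP (pickle (i, j)); rewrite /cell pickleK.
Qed.

End Arrays.

(** Cells (f t, f t) are moved to (g t, f t) by indiscernibility of the rows,
    then to (g t, g t) by indiscernibility of the columns. *)
Lemma indiscernible_diagonal (L : language) (M : structure L) (A : set M) m
    (a : nat -> nat -> 'I_m -> M) :
  indiscernible_array A a -> indiscernible A (fun i => a i i).
Proof.
case=> rows cols k f g incf incg phi.
pose cell (h : 'I_k -> nat) (x : 'I_k * 'I_m + A) : 'I_k * (nat * 'I_m) + A :=
  match x with inl tu => inl (tu.1, (h tu.1, tu.2)) | inr x => inr x end.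
have := rows k f g incf incg (rename (cell f) phi).
have := cols k f g incf incg (rename (cell g) phi).
rewrite !sat_rename.
rewrite (_ : _ \o cell g = pair_val (fun ij => a (g ij.1) (f ij.1) ij.2) set_val);
  last by apply: funext => -[].
rewrite (_ : _ \o cell g = pair_val (fun ij => a (g ij.1) (g ij.1) ij.2) set_val);
  last by apply: funext => -[].
rewrite (_ : _ \o cell f = pair_val (fun ij => a (f ij.1) (f ij.1) ij.2) set_val);
  last by apply: funext => -[].
rewrite (_ : _ \o cell f = pair_val (fun ij => a (g ij.1) (f ij.1) ij.2) set_val);
  last by apply: funext => -[].
by move=> ? ?; apply: iff_trans; eassumption.
Qed.

Theorem corollary1p8 (L : language) (T : theory L) (kappa : Type)
    (M : structure L) (A : set M) (n m : nat)
    (phi : formula L ('I_n + 'I_m)) (a : 'I_m -> M) :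
  complete T -> monster kappa T M -> NTP2 M -> small kappa A ->
  (divides A phi a <-> array_divides A phi a).
Proof.
move=> _ /countably_saturated_monster satM ntp2 _.
split=> [[b [indb b0 inc_b]]|[b [indb b00 inc_b]]].
  exists (fun i _ => b i); split=> //.
    split=> k f g incf incg psi //.
    pose r (x : 'I_k * (nat * 'I_m) + A) : 'I_k * 'I_m + A :=
      match x with inl tu => inl (tu.1, tu.2.2) | inr x => inr x end.
    have := indb k f g incf incg (rename r psi); rewrite !sat_rename.
    rewrite (_ : _ \o r = pair_val (fun ij => b (f ij.1) ij.2.2) set_val);
      last by apply: funext => -[].
    rewrite (_ : _ \o r = pair_val (fun ij => b (g ij.1) ij.2.2) set_val) //.
    by apply: funext => -[].
  by move=> [c cP]; apply: inc_b; exists c => i; apply: (cP (i, 0)).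
exists (fun i => b i i); split=> //; first exact: indiscernible_diagonal.
move=> con_diag; apply: inc_b.
have dphi : definable (sat (M := M) phi) by exists phi.
have [c cP] := array_realized satM ntp2 dphi (indiscernible_array_shift indb) con_diag.
by exists c => -[i j]; apply: cP.
Qed.
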